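(* Let $m\ge 0$, and let $(A_i,B_i)$, $1\le i\le m$, be pairs of subspaces of an $n$-dimensional vector space $V$ over an arbitrary field $\mathbb F$, with positive dimensions $a_i=\dim A_i$ and $b_i=\dim B_i$, such that $$A_i\cap B_i=\{0\}\ \text{ for all } i,\qquad A_i\cap B_j\ne\{0\}\ \text{ for all } i\ne j.$$ For any choice of nonzero elements $u_i\in\Lambda^{a_i}A_i$ ($1\le i\le m$), if a graded ideal $M\subseteq\mathcal E(V)$ satisfies $$\sum_{i=1}^m u_i\wedge(B_i)\ \subseteq\ M\ \subseteq\ \bigcap_{i=1}^m (B_i),$$ then, for every integer $k$ with $0\le k\le n+1$, $$\lambda_n(M,k)\ \ge\ \sum_{i=1}^m b_i\binom{n-a_i-b_i}{k-a_i-1}.$$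
   Context: For an $n$-dimensional vector space $V$ over a field $\mathbb F$, $\mathcal E(V)=\bigoplus_{j=0}^n\Lambda^jV$ is the exterior algebra. For $u\in\mathcal E(V)$ and $A\subseteq\mathcal E(V)$, $u\wedge A=\{u\wedge a: a\in A\}$. For a subspace $S\subseteq V$, $(S)$ denotes the ideal of $\mathcal E(V)$ generated by $S$, i.e. $(S)=\operatorname{span}_{\mathbb F}\{s\wedge a: s\in S,\ a\in\mathcal E(V)\}$. For a subspace $U\subseteq V$, $\Lambda^jU$ is regarded as a subspace of $\Lambda^jV$. An ideal $M\subseteq\mathcal E(V)$ is graded if $M=\bigoplus_{j=0}^n M_j$ with $M_j=M\cap\Lambda^jV$; set $\Lambda^jV=0$ and $M_j=0$ for $j\notin\{0,\dots,n\}$. For a graded ideal $M$ and an integer $k$, $$\lambda_n(M,k)=k\dim M_k-(n-k+1)\dim M_{k-1}.$$ Conventions: an empty sum of ideals is $0$, an empty intersection of ideals is $\mathcal E(V)$, and $\binom{a}{b}=0$ for integers $a\ge 0$ and $b\notin\{0,\dots,a\}$. (Note $a_i+b_i\le n$ since $A_i\cap B_i=\{0\}$.) *)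

(* Defs.v *)
From HB Require Import structures.
From mathcomp Require Import all_boot all_order all_algebra all_field.

Set Implicit Arguments.
Unset Strict Implicit.
Unset Printing Implicit Defensive.

Import Order.TTheory GRing.Theory Num.Theory.
Local Open Scope ring_scope.

(* The exterior algebra of V, in coordinates on the monomials                 *)
(*   e_S = b_(i_1) /\ ... /\ b_(i_k),  S = {i_1 < ... < i_k},                 *)
(* where b = vbasis {:V}: an element is the family of its coefficients. The   *)
(* exterior product is the product x * y of the falgType structure. ext_in_sq,*)
(* ext_univ and ext_univ_uniq below establish the universal property, so the  *)
(* choice of the basis is immaterial.                                         *)
Definition exterior (F : fieldType) (V : vectType F) : Type :=
  {ffun {set 'I_(\dim {:V})} -> F^o}.

Section Inversions.

Variable n : nat.
Implicit Types S T U : {set 'I_n}.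

(* e_S * e_T = (-1) ^+ ninv S T *: e_(S :|: T) when S and T are disjoint *)
Definition ninv S T : nat := #|[set p in setX S T | (p.2 < p.1)%N]|.

Lemma ninvE S T : ninv S T = (\sum_(i in S) \sum_(j in T) (j < i))%N.
Proof.
rewrite /ninv -sum1_card pair_big /= [RHS]big_mkcond [LHS]big_mkcond /=.
apply: eq_bigr => -[i j] _; rewrite !inE /=.
by case: (i \in S); case: (j \in T) => //=; case: (j < i)%N.
Qed.

Lemma big_disjU (R : Type) (idx : R) (op : Monoid.com_law idx) S T G :
  [disjoint S & T] ->
  \big[op/idx]_(i in S :|: T) G i =
    op (\big[op/idx]_(i in S) G i) (\big[op/idx]_(i in T) G i).
Proof.
by move=> dST; rewrite -bigU //=; apply: eq_bigl => i; rewrite !inE.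
Qed.

Lemma ninvUl S T U :
  [disjoint S & T] -> ninv (S :|: T) U = (ninv S U + ninv T U)%N.
Proof. by move=> dST; rewrite !ninvE big_disjU. Qed.

Lemma ninvUr S T U :
  [disjoint T & U] -> ninv S (T :|: U) = (ninv S T + ninv S U)%N.
Proof.
move=> dTU; rewrite !ninvE -big_split /=.
by apply: eq_bigr => i _; rewrite big_disjU.
Qed.

Lemma subsetUD S T : S \subset T -> S :|: (T :\: S) = T.
Proof. by move=> sST; rewrite setDE setUIr setUCr setIT; apply/setUidPr. Qed.

Lemma ninv0l S : ninv set0 S = 0%N.
Proof. by rewrite ninvE big_set0. Qed.

Lemma ninv0r S : ninv S set0 = 0%N.
Proof. by rewrite ninvE big1 // => i _; rewrite big_set0. Qed.

Lemma set_ind_min (P : {set 'I_n} -> Prop) :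
  P set0 ->
  (forall (i : 'I_n) S, (forall j, j \in S -> (i < j)%N) -> P S -> P (i |: S)) ->
  forall S, P S.
Proof.
move=> P0 PU S; elim: {S}#|S| {-2}S (erefl #|S|) => [|k IH] S cS.
  by rewrite (cards0_eq cS).
have /set0Pn[i0 Si0] : S != set0 by rewrite -card_gt0 cS.
case: (arg_minnP (fun i : 'I_n => i : nat) Si0) => i Si mini.
have {}Si : i \in S by [].
rewrite -(setD1K Si); apply: PU => [j|].
  by rewrite !inE => /andP[nji /mini]; rewrite leq_eqVlt eq_sym val_eqE (negPf nji).
by apply: IH; move: cS; rewrite (cardsD1 i) Si => -[].
Qed.

End Inversions.

Section ExteriorAlgebra.

Variables (F : fieldType) (V : vectType F).
Local Notation n := (\dim {:V}).
Local Notation E := (exterior V).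

HB.instance Definition _ := Vector.copy E {ffun {set 'I_n} -> F^o}.

Implicit Types (x y z : E) (S T U : {set 'I_n}).

Definition wedge x y : E :=
  [ffun U : {set 'I_n} => \sum_(S : {set 'I_n} | S \subset U)
               (-1) ^+ ninv S (U :\: S) * (x S * y (U :\: S))].

Definition ext1 : E := [ffun S : {set 'I_n} => (S == set0)%:R].

Lemma extD x y S : (x + y) S = x S + y S.
Proof. by rewrite ffunE. Qed.

Lemma extZ (a : F) x S : (a *: x) S = a * x S.
Proof. by rewrite ffunE. Qed.

Fact wedgeA : associative wedge.
Proof.
move=> x y z; apply/ffunP=> U; rewrite !ffunE.
under eq_bigr => S sSU do rewrite ffunE !mulr_sumr.
under [RHS]eq_bigr => S sSU do rewrite ffunE mulr_suml mulr_sumr.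
rewrite [RHS](exchange_big_dep (fun S => S \subset U)) /=; last first.
  by move=> W S sWU sSW; apply: subset_trans sSW sWU.
apply: eq_bigr => S sSU.
rewrite [RHS](reindex_onto (fun T => S :|: T) (fun W => W :\: S)) /=; last first.
  by move=> W /andP[_ sSW]; rewrite subsetUD.
apply: eq_big => T.
  rewrite subUset sSU subsetUl /= setDUl setDv set0U andbT.
  by rewrite subsetD; congr (_ && _); apply/idP/eqP => /setDidPl.
rewrite subsetD => /andP[sTU dTS].
have -> : (S :|: T) :\: S = T.
  by rewrite setDUl setDv set0U; apply/setDidPl.
have -> : U :\: (S :|: T) = U :\: S :\: T by rewrite setDDl.
have dT : [disjoint T & U :\: S :\: T].
  by rewrite disjoint_sym disjoints_subset subDset setUCr subsetT.
have dST : [disjoint S & T] by rewrite disjoint_sym.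
rewrite ninvUl //.
have -> : ninv S (U :\: S) = (ninv S T + ninv S (U :\: S :\: T))%N.
  rewrite -ninvUr //; congr ninv.
  by rewrite subsetUD // subsetD sTU.
rewrite !exprD -!mulrA [RHS]mulrCA [in RHS]mulrCA [LHS]mulrCA; congr (_ * _).
by rewrite [RHS]mulrCA; congr (_ * _); rewrite mulrCA.
Qed.

Fact wedge1l : left_id ext1 wedge.
Proof.
move=> x; apply/ffunP=> U; rewrite ffunE (bigD1 set0) ?sub0set //=.
rewrite ffunE eqxx setD0 ninv0l !mul1r big1 ?addr0 // => S /andP[_ /negPf S0].
by rewrite ffunE S0 mul0r mulr0.
Qed.

Fact wedge1r : right_id ext1 wedge.
Proof.
move=> x; apply/ffunP=> U; rewrite ffunE (bigD1 U) //=.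
rewrite ffunE setDv eqxx ninv0r mulr1 mul1r big1 ?addr0 // => S /andP[sSU nSU].
rewrite ffunE setD_eq0; case: (boolP (U \subset S)) => [sUS|_].
  by rewrite eqEsubset sSU sUS in nSU.
by rewrite !mulr0.
Qed.

Fact wedgeDl : left_distributive wedge +%R.
Proof.
move=> x y z; apply/ffunP=> U; rewrite !ffunE -big_split /=.
by apply: eq_bigr => S _; rewrite extD mulrDl mulrDr.
Qed.

Fact wedgeDr : right_distributive wedge +%R.
Proof.
move=> x y z; apply/ffunP=> U; rewrite !ffunE -big_split /=.
by apply: eq_bigr => S _; rewrite extD !mulrDr.
Qed.

Fact ext1_neq0 : ext1 != 0.
Proof.
by apply/eqP => /ffunP/(_ set0)/eqP; rewrite !ffunE eqxx oner_eq0.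
Qed.

HB.instance Definition _ := GRing.Zmodule_isNzRing.Build E
  wedgeA wedge1l wedge1r wedgeDl wedgeDr ext1_neq0.

Lemma extME x y U : (x * y) U =
  \sum_(S : {set 'I_n} | S \subset U)
     (-1) ^+ ninv S (U :\: S) * (x S * y (U :\: S)).
Proof. by rewrite ffunE. Qed.

Fact wedgeZl (a : F) x y : a *: (x * y) = (a *: x) * y.
Proof.
apply/ffunP=> U; rewrite extZ !extME mulr_sumr.
by apply: eq_bigr => S _; rewrite extZ mulrCA !mulrA.
Qed.

HB.instance Definition _ := GRing.Lmodule_isLalgebra.Build F E wedgeZl.

Fact wedgeZr (a : F) x y : a *: (x * y) = x * (a *: y).
Proof.
apply/ffunP=> U; rewrite extZ !extME mulr_sumr.
by apply: eq_bigr => S _; rewrite extZ mulrCA; congr (_ * _); rewrite mulrCA.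
Qed.

HB.instance Definition _ := GRing.Lalgebra_isAlgebra.Build F E wedgeZr.
HB.instance Definition _ := Algebra_isFalgebra.Build F E.

Definition ext_mono S : E := [ffun T : {set 'I_n} => (T == S)%:R].

Definition ext_in (v : V) : E :=
  \sum_(i < n) coord (vbasis {:V}) i v *: ext_mono [set i].

Fact ext_in_linear : linear ext_in.
Proof.
move=> a u v; rewrite /ext_in scaler_sumr -big_split /=.
by apply: eq_bigr => i _; rewrite linearP scalerDl scalerA.
Qed.

HB.instance Definition _ := GRing.isLinear.Build F V E _ ext_in ext_in_linear.


Lemma ext_monoE S T : ext_mono S T = (T == S)%:R.
Proof. by rewrite ffunE. Qed.

Lemma ext_expand x : x = \sum_S x S *: ext_mono S.
Proof.
apply/ffunP=> T; rewrite sum_ffunE (bigD1 T) //= extZ ext_monoE eqxx mulr1.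
rewrite big1 ?addr0 // => S /negPf nST.
by rewrite extZ ext_monoE eq_sym nST mulr0.
Qed.

Lemma ext_monoM S T : ext_mono S * ext_mono T =
  if [disjoint S & T] then (-1) ^+ ninv S T *: ext_mono (S :|: T) else 0.
Proof.
apply/ffunP=> U; rewrite extME.
have [sSU|nSU] := boolP (S \subset U); last first.
  rewrite big1 => [|W sWU]; last first.
    rewrite ext_monoE; case: eqP => [eWS|_]; last by rewrite mul0r mulr0.
    by rewrite -eWS sWU in nSU.
  case: ifP => _; last by rewrite ffunE.
  rewrite extZ ext_monoE; case: eqP => [eU|_]; last by rewrite mulr0.
  by rewrite eU subsetUl in nSU.
rewrite (bigD1 S) //= big1 => [|W /andP[_ /negPf nWS]]; last first.
  by rewrite ext_monoE nWS mul0r mulr0.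
rewrite addr0 !ext_monoE eqxx mul1r.
have [dST|nST] := boolP [disjoint S & T]; last first.
  rewrite ffunE; case: eqP => [eT|_]; last by rewrite mulr0.
  by rewrite -eT disjoints_subset setCD subsetUr in nST.
rewrite extZ ext_monoE; have -> : (U == S :|: T) = (U :\: S == T).
  apply/eqP/eqP => [->|<-]; last by rewrite subsetUD.
  by rewrite setDUl setDv set0U; apply/setDidPl; rewrite disjoint_sym.
by case: eqP => [->|_] //; rewrite !mulr0.
Qed.

Lemma ext_mono0 : ext_mono set0 = 1.
Proof. by []. Qed.

Lemma ext_mono_lt (i : 'I_n) S : (forall j, j \in S -> (i < j)%N) ->
  ext_mono (i |: S) = ext_mono [set i] * ext_mono S.
Proof.
move=> ltiS; rewrite ext_monoM disjoints1.
case: (boolP (i \in S)) => [/ltiS|iS]; first by rewrite ltnn.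
rewrite ninvE big_set1 big1 ?scale1r // => j /ltiS.
by case: ltngtP.
Qed.

Lemma ext_mono1C (i j : 'I_n) :
  ext_mono [set i] * ext_mono [set j] = - (ext_mono [set j] * ext_mono [set i]).
Proof.
rewrite !ext_monoM !disjoints1 !inE eq_sym [j == i]eq_sym.
case: (eqVneq i j) => [_|neq] /=; first by rewrite oppr0.
rewrite setUC !ninvE !big_set1.
have : (i : nat) != j by [].
by case: ltngtP => //= _ _; rewrite expr0 expr1 !scaleNr !scale1r ?opprK.
Qed.

Lemma ext_mono1_sq (i : 'I_n) : ext_mono [set i] * ext_mono [set i] = 0.
Proof. by rewrite ext_monoM disjoints1 inE eqxx. Qed.

Lemma sum_alt (A : zmodType) m (G : 'I_m -> 'I_m -> A) :
  (forall i, G i i = 0) -> (forall i j, G i j = - G j i) ->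
  \sum_i \sum_j G i j = 0.
Proof.
move=> G0 GN.
have E i : \sum_j G i j =
    \sum_(j : 'I_m | (i < j)%N) G i j + \sum_(j : 'I_m | (j < i)%N) G i j.
  rewrite (bigID (fun j : 'I_m => (i < j)%N)) /=; congr (_ + _).
  rewrite (bigID (fun j : 'I_m => j == i)) /= big1 ?add0r => [|j /andP[_ /eqP->]] //.
  by apply: eq_bigl => j; rewrite -leqNgt ltn_neqAle andbC.
rewrite (eq_bigr _ (fun i _ => E i)) big_split /=.
rewrite [X in _ + X](exchange_big_dep predT) //= -big_split /=.
apply: big1 => i _; rewrite -big_split /=; apply: big1 => j _.
by rewrite GN addNr.
Qed.

Lemma ext_in_sq (v : V) : ext_in v * ext_in v = 0.
Proof.
rewrite {1}/ext_in mulr_suml.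
under eq_bigr => i _ do rewrite /ext_in mulr_sumr.
apply: sum_alt => [i|i j].
  by rewrite -scalerAl -scalerAr ext_mono1_sq !scaler0.
by rewrite -!scalerAl -!scalerAr ext_mono1C !scalerN !scalerA mulrC.
Qed.

Lemma ext_in_basis (i : 'I_n) : ext_in (vbasis {:V})`_i = ext_mono [set i].
Proof.
rewrite /ext_in (bigD1 i) //= big1 ?addr0 => [|j nji]; last first.
  by rewrite coord_free ?(basis_free (vbasisP _)) // eq_sym (negPf nji) scale0r.
by rewrite coord_free ?(basis_free (vbasisP _)) // eqxx scale1r.
Qed.

Theorem ext_univ_uniq (A : algType F) (g h : {lrmorphism E -> A}) :
  (forall v, g (ext_in v) = h (ext_in v)) -> g =1 h.
Proof.
move=> gh x; rewrite (ext_expand x) !linear_sum; apply: eq_bigr => S _.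
rewrite !linearZ /=; congr (_ *: _); elim/set_ind_min: S => [|i S ltiS IH].
  by rewrite ext_mono0 !rmorph1.
by rewrite ext_mono_lt // !rmorphM /= IH -ext_in_basis gh.
Qed.

Section Universal.

Variables (A : algType F) (f : {linear V -> A}).
Hypothesis f_sq : forall v, f v * f v = 0.

Let b (i : 'I_n) : A := f (vbasis {:V})`_i.

Let b_sq i : b i * b i = 0. Proof. exact: f_sq. Qed.

Let bC i j : b i * b j = - (b j * b i).
Proof.
have := f_sq ((vbasis {:V})`_i + (vbasis {:V})`_j).
rewrite linearD mulrDl !mulrDr !f_sq add0r addr0.
by move/eqP; rewrite addr_eq0 => /eqP.
Qed.

Let P S : A := \prod_(i <- enum S) b i.

Let P0 : P set0 = 1. Proof. by rewrite /P enum_set0 big_nil. Qed.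

Let Pmin (i : 'I_n) S : (forall j, j \in S -> (i < j)%N) ->
  P (i |: S) = b i * P S.
Proof.
move=> ltiS; rewrite /P; suff -> : enum (i |: S) = i :: enum S.
  by rewrite big_cons.
have srt (T : {set 'I_n}) : sorted ltn (map val (enum T)).
  apply: (subseq_sorted ltn_trans (s2 := iota 0 n)); last exact: iota_ltn_sorted.
  by rewrite -val_enum_ord [enum 'I_n]enumT; apply/map_subseq/filter_subseq.
apply: (inj_map val_inj); apply: (irr_sorted_eq ltn_trans ltnn) => //.
  rewrite /= path_min_sorted // all_map; apply/allP => j /=.
  by rewrite mem_enum => /ltiS.
move=> k; apply/mapP/mapP => -[j jE ->]; exists j => //;
  by move: jE; rewrite inE !mem_enum !inE.
Qed.

Let bP (i : 'I_n) S : b i * P S =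
  if i \in S then 0 else (-1) ^+ ninv [set i] S *: P (i |: S).
Proof.
elim/set_ind_min: S => [|j S ltjS IH].
  by rewrite inE ninv0r Pmin ?scale1r // => ?; rewrite inE.
have jS : j \notin S by apply/negP => /ltjS; rewrite ltnn.
rewrite Pmin //; case: (ltngtP i j) => [ltij|ltji|/val_inj->].
- have lt k : k \in j |: S -> (i < k)%N.
    by rewrite !inE => /orP[/eqP->//|/ltjS]; apply: ltn_trans.
  case: (boolP (i \in _)) => [/lt|_]; first by rewrite ltnn.
  rewrite [in RHS]Pmin // Pmin // ninvE big_set1 big1 ?scale1r // => k /lt.
  by case: ltngtP.
- rewrite mulrA bC mulNr -mulrA IH !inE -val_eqE gtn_eqF //=.
  case: ifP => iS; first by rewrite mulr0 oppr0.
  rewrite ninvUr ?disjoints1 // exprD.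
  have -> : ninv [set i] [set j] = 1%N by rewrite ninvE !big_set1 ltji.
  rewrite mulN1r scaleNr setUCA [in RHS]Pmin; first by rewrite scalerAr.
  by move=> k; rewrite !inE => /orP[/eqP->//|/ltjS].
- by rewrite mulrA b_sq mul0r !inE eqxx.
Qed.

Definition ext_lift x : A := \sum_S x S *: P S.

Fact ext_lift_linear : linear ext_lift.
Proof.
move=> a x y; rewrite /ext_lift scaler_sumr -big_split /=.
by apply: eq_bigr => S _; rewrite extD extZ scalerDl scalerA.
Qed.

HB.instance Definition _ := GRing.isLinear.Build F E A _ ext_lift ext_lift_linear.

Let lift_mono S : ext_lift (ext_mono S) = P S.
Proof.
rewrite /ext_lift (bigD1 S) //= ext_monoE eqxx scale1r big1 ?addr0 // => T /negPf nTS.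
by rewrite ext_monoE nTS scale0r.
Qed.

Let lift_monoid : monoid_morphism ext_lift.
Proof.
split=> [|x y]; first by rewrite -ext_mono0 lift_mono P0.
have g1 i z : ext_lift (ext_mono [set i] * z) = b i * ext_lift z.
  rewrite (ext_expand z) mulr_sumr !linear_sum mulr_sumr; apply: eq_bigr => S _.
  rewrite -scalerAr !linearZ /= -scalerAr; congr (_ *: _).
  rewrite ext_monoM disjoints1 if_neg lift_mono bP; case: ifP => _.
    exact: linear0.
  by rewrite linearZ /= lift_mono.
rewrite {1 2}(ext_expand x) mulr_suml !linear_sum mulr_suml.
apply: eq_bigr => S _; rewrite -scalerAl !linearZ /= -scalerAl.
congr (_ *: _); elim/set_ind_min: S => [|i S ltiS IH].
  by rewrite ext_mono0 mul1r -ext_mono0 lift_mono P0 mul1r.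
by rewrite ext_mono_lt // -mulrA !g1 IH mulrA.
Qed.

Theorem ext_univ : exists h : {lrmorphism E -> A}, forall v, h (ext_in v) = f v.
Proof.
pose h : {lrmorphism E -> A} := HB.pack ext_lift
  (GRing.isLinear.Build F E A _ ext_lift ext_lift_linear)
  (GRing.isMonoidMorphism.Build E A ext_lift lift_monoid).
exists h => v; rewrite /h /= /ext_in linear_sum {2}(coord_vbasis (memvf v)) linear_sum.
apply: eq_bigr => i _; rewrite !linearZ /= lift_mono; congr (_ *: _).
rewrite -[[set i]]setU0 Pmin ?P0 ?mulr1 // => ?.
by rewrite inE.
Qed.

End Universal.

End ExteriorAlgebra.

Section GradedIdeals.

Variables (F : fieldType) (V : vectType F).
Local Notation n := (\dim {:V}).
Local Notation E := (exterior V).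

Implicit Types (U : {vspace V}) (M : {vspace E}) (k : int).

(* The image of U in degree 1. *)
Definition ext_sub U : {vspace E} := (linfun (@ext_in F V) @: U)%VS.

(* Lambda^k U, as the span of the products of k vectors of U; it is 0 for     *)
(* k > dim V (see memv_ext_pow), and for k < 0 by convention.                 *)
Definition ext_pow U k : {vspace E} :=
  if k is Posz j then (ext_sub U ^+ j)%VS else 0%VS.

(* (U * W)%VS being the span of the products u * w, this is the ideal (U). *)
Definition ext_ideal U : {vspace E} := (ext_sub U * {:E})%VS.

Definition is_ideal M : bool := ({:E} * M <= M)%VS && (M * {:E} <= M)%VS.

Definition ideal_part M k : {vspace E} := (M :&: ext_pow {:V} k)%VS.

Definition graded_ideal M : Prop :=
  [/\ is_ideal M, (\sum_(j < n.+1) ideal_part M j)%VS = M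
    & directv (\sum_(j < n.+1) ideal_part M j)].

Definition lambda (d : nat) M k : int :=
  k * (\dim (ideal_part M k))%:Z
  - (d%:Z - k + 1) * (\dim (ideal_part M (k - 1)))%:Z.

Let W (j : nat) : {vspace E} :=
  (\sum_(S : {set 'I_n} | #|S| == j) <[ext_mono S]>)%VS.

Let monoW S : ext_mono S \in W #|S|.
Proof. by apply: (subvP (sumv_sup S _ (subvv _))); rewrite ?memv_line. Qed.

Let WP j (x : E) : (x \in W j) = [forall S, (x S != 0) ==> (#|S| == j)].
Proof.
apply/idP/forallP => [/memv_sumP[v vin ->] S|xj].
  apply/implyP; apply: contraR => cS; rewrite sum_ffunE big1 // => T /eqP cT.
  have /vlineP[c ->] := vin T (introT eqP cT).
  rewrite extZ ext_monoE; case: eqP => [eST|_]; last by rewrite mulr0.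
  by rewrite eST cT eqxx in cS.
rewrite (ext_expand x); apply: memv_suml => S _.
have [->|xS] := eqVneq (x S) 0; first by rewrite scale0r mem0v.
by apply: memvZ; have /implyP/(_ xS)/eqP <- := xj S.
Qed.

Lemma memv_ext_pow (j : nat) (x : E) :
  (x \in ext_pow {:V} j) = [forall S, (x S != 0) ==> (#|S| == j)].
Proof.
suff -> : ext_pow {:V} j = W j by apply: WP.
apply/eqP; rewrite eqEsubv; apply/andP; split.
  rewrite /=; elim: j {x} => [|j IH].
    by rewrite expv0 -memvE -ext_mono0 -[0%N](@cards0 'I_n) monoW.
  rewrite expvSl; apply: subv_trans (prodvSr _ IH) _.
  apply/prodvP => _ y /memv_imgP[v _ ->] yW; rewrite lfunE /= /ext_in mulr_suml.
  apply: memv_suml => i _; rewrite -scalerAl memvZ //.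
  have /memv_sumP[z zW ->] := yW; rewrite mulr_sumr.
  apply: memv_suml => S cS; have /vlineP[c ->] := zW S cS.
  rewrite -scalerAr memvZ // ext_monoM disjoints1; case: ifP => [iS|_].
    have <- : #|i |: S| = j.+1 by rewrite cardsU1 iS (eqP cS).
    by rewrite memvZ // monoW.
  exact: mem0v.
apply/subv_sumP => S cS; rewrite -memvE -(eqP cS) /= {j x cS}.
elim/set_ind_min: S => [|i S ltiS IH].
  by rewrite cards0 expv0 ext_mono0 memv_line.
have iS : i \notin S by apply/negP => /ltiS; rewrite ltnn.
rewrite ext_mono_lt // cardsU1 iS add1n expvSl memv_mul //.
by apply/memv_imgP; exists (vbasis {:V})`_i; rewrite ?memvf // lfunE /= ext_in_basis.
Qed.

End GradedIdeals.

(* 'C(a, b) for an integer b; it is 0 unless 0 <= b <= a. *)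
Definition binz (a : nat) (b : int) : nat :=
  if b is Posz c then 'C(a, c) else 0%N.

(* Main.v *)
Require Import Defs.
From HB Require Import structures.
From mathcomp Require Import all_boot all_order all_algebra all_field.
From mathcomp Require Import zify.

Set Implicit Arguments.
Unset Strict Implicit.
Unset Printing Implicit Defensive.

Import Order.TTheory GRing.Theory Num.Theory.
Local Open Scope ring_scope.

(* For v in V, let M1 and M2 be the ideals of the exterior algebra of V / v   *)
(* given by the image of M and by {w | w /\ v in M}. Then                     *)
(*   lambda_n(M, k) = lambda_(n-1)(M1, k) + lambda_(n-1)(M2, k - 1)           *)
(*                    + dim (M2)_(k-1) - dim (M1)_(k-1),                      *)
(* and M1 is contained in M2. If v avoids all A_i + B_i, both ideals satisfy  *)
(* the hypotheses with the same pairs, and the bound follows by induction     *)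
(* from Pascal's rule. A pair with A_i + B_i = V cannot be projected, but it  *)
(* contributes only for k = a_i + 1; then adjoining u_i to M raises           *)
(* dim M_(k-1) by one without changing M_k, hence lowers lambda by            *)
(* n - k + 1 = b_i, while the other pairs keep their hypotheses because       *)
(* u_i lies in every other (B_j). The vector v exists over an infinite field, *)
(* so scalars are first extended from F to F(X). Instead of quotients of V,   *)
(* the induction uses ideals of the exterior algebra of V containing (L),     *)
(* where L is the span of the vectors chosen so far; this keeps A_i, B_i and  *)
(* u_i unchanged.                                                             *)

(** * The exterior algebra and the ideals (U) *)

(** The outline above rests on one fact about ideals: if v is not in W, then x /\ v in (W) forces x
    into (W + <v>) ([ext_ideal_colon], by contraction with a linear form that vanishes on W and is 1
    at v). This fact keeps {w | w /\ v in M} inside every (B_i + L + <v>) ([sandwiched_colon]) and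
    puts u_i into (B_j) when A_i meets B_j ([ext_pow_dim_ideal]). The recursion for dimensions is
    rank-nullity for multiplication by v ([dim_add_limg], [reldim_split]). The pairs that fill V / L
    are disposed of by [lambda_ge_reduce], the induction on dim V / L is [sandwiched_lambda], and
    [lambda_ge_of_extension] brings the bound back from an extension field, since extending scalars
    preserves dimensions. *)

Section ExteriorFacts.

Variables (F : fieldType) (V : vectType F).
Local Notation E := (exterior V).
Local Notation ι := (@ext_in F V).
Local Notation Λ j := (ext_pow {:V} (Posz j)).
Implicit Types (U W : {vspace V}) (v w : V) (x y : E).

Lemma mem_ext_sub U v : v \in U -> ι v \in ext_sub U.
Proof. by move=> Uv; rewrite -(lfunE (ι)) memv_img. Qed.

Lemma ext_subP U x : reflect (exists2 v, v \in U & x = ι v) (x \in ext_sub U).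
Proof.
apply: (iffP memv_imgP) => -[v Uv ->]; exists v => //; by rewrite lfunE.
Qed.

Lemma ext_subS U W : (U <= W)%VS -> (ext_sub U <= ext_sub W)%VS.
Proof. exact: limgS. Qed.

Lemma ext_subD U W : (ext_sub (U + W) = ext_sub U + ext_sub W)%VS.
Proof. exact: limgD. Qed.

Lemma ext_sub_line v : (ext_sub <[v]> = <[ι v]>)%VS.
Proof. by rewrite /ext_sub limg_line lfunE. Qed.

Lemma ext_inC v w : ι v * ι w = - (ι w * ι v).
Proof.
have := ext_in_sq (v + w); rewrite linearD mulrDl !mulrDr !ext_in_sq add0r addr0.
by move/eqP; rewrite addr_eq0 => /eqP.
Qed.

Lemma ext_subC U W : (ext_sub U * ext_sub W = ext_sub W * ext_sub U)%VS.
Proof.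
have sub U' W' : (ext_sub U' * ext_sub W' <= ext_sub W' * ext_sub U')%VS.
  apply/prodvP => _ _ /ext_subP[v Uv ->] /ext_subP[w Ww ->].
  by rewrite ext_inC memvN memv_mul ?mem_ext_sub.
by apply/eqP; rewrite eqEsubv !sub.
Qed.

Lemma ext_powC U W (j : nat) :
  (ext_sub W * ext_pow U j = ext_pow U j * ext_sub W)%VS.
Proof.
rewrite /=; elim: j => [|j IH]; first by rewrite expv0 prodv1 prod1v.
by rewrite expvSl prodvA ext_subC -prodvA IH prodvA.
Qed.

Lemma ext_powS (j : nat) : (Λ j * ext_sub {:V} = Λ j.+1)%VS.
Proof. by rewrite /= expvSr. Qed.

Lemma ext_pow_sub U (j : nat) : (ext_pow U j <= Λ j)%VS.
Proof. by apply: expvS; apply: ext_subS; apply: subvf. Qed.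

Lemma ext_sub_pow1 U (j : nat) : (Λ j * ext_sub U <= Λ j.+1)%VS.
Proof. by rewrite -ext_powS prodvSr // ext_subS ?subvf. Qed.

Lemma ext_pow_coef0 (j : nat) x (S : {set 'I_(\dim {:V})}) :
  x \in Λ j -> #|S| != j -> x S = 0.
Proof.
by rewrite (memv_ext_pow j) => /forallP/(_ S); case: (eqVneq (x S) 0) => //= _ ->.
Qed.

Lemma ext_grading : (\sum_(j < (\dim {:V}).+1) Λ j)%VS = fullv.
Proof.
apply/eqP; rewrite eqEsubv subvf; apply/subvP => x _.
rewrite (ext_expand x); apply: memv_suml => S _; apply: memvZ.
have ltS : (#|S| < (\dim {:V}).+1)%N by rewrite ltnS -[X in (_ <= X)%N]card_ord max_card.
apply: (subvP (sumv_sup (Ordinal ltS) _ (subvv _))) => //=.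
rewrite (memv_ext_pow #|S|); apply/forallP => T; rewrite ext_monoE.
by case: (T =P S) => [->|_]; rewrite ?eqxx ?implybT //=.
Qed.

(** Induction on the degree: right multiplication by vectors reaches everything from 1. A linear
    identity on the whole algebra can thus be checked one vector at a time. *)
Lemma ext_subspace_full (X : {vspace E}) :
  1 \in X -> (X * ext_sub {:V} <= X)%VS -> X = fullv.
Proof.
move=> X1 XV; apply/eqP; rewrite eqEsubv subvf -ext_grading.
apply/subv_sumP => -[j _] _ /=; elim: j => [|j IH].
  by rewrite expv0 -memvE.
by rewrite expvSr; apply: subv_trans XV; apply: prodvSl.
Qed.

Lemma ext_ideal_right U : ext_ideal U = ({:E} * ext_sub U)%VS.
Proof.
rewrite /ext_ideal -ext_grading big_distrr big_distrl /=.
by apply: eq_bigr => j _; rewrite -/(ext_pow _ (Posz j)) ext_powC.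
Qed.

End ExteriorFacts.

(** * Contraction by a linear form *)

Section Contraction.

Variables (F : fieldType) (V : vectType F) (f : {scalar V}).
Local Notation E := (exterior V).
Local Notation ι := (@ext_in F V).

Local Notation EE := (E * E)%type.

Let step v (p : EE) : EE := (p.1 * ι v, f v *: p.1 - p.2 * ι v).

Let step_linear v : linear (step v).
Proof.
move=> a [p1 p2] [q1 q2]; congr (_, _) => /=; first by rewrite mulrDl scalerAl.
rewrite mulrDl -scalerAl opprD !scalerDr addrACA scalerN.
by rewrite !scalerA mulrC.
Qed.

Let stepL v : {linear EE -> EE} :=
  HB.pack (step v) (GRing.isLinear.Build F _ _ _ (step v) (step_linear v)).

Let op v : 'End(EE) := linfun (stepL v).

Let op_linear : linear op.
Proof.
move=> a v w; apply/lfunP => p.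
rewrite add_lfunE scale_lfunE !lfunE /= /step.
congr (_, _) => /=; first by rewrite linearP mulrDr scalerAr.
rewrite !linearP /= mulrDr -scalerAr scalerDl opprD addrACA.
by rewrite scalerN !scalerA mulrC.
Qed.

Let proper_dim : (0 < dim EE)%N.
Proof.
rewrite -dimvf lt0n dimv_eq0; apply: contraTneq (memvf ((1, 0) : EE)) => ->.
by rewrite memv0; apply/eqP => -[] /eqP; rewrite oner_eq0.
Qed.

Let opL : {linear V -> lfun_algType proper_dim} :=
  HB.pack (op : V -> lfun_algType proper_dim)
    (GRing.isLinear.Build F V (lfun_algType proper_dim) _ op op_linear).

Let op_sq v : opL v * opL v = 0.
Proof.
apply/lfunP => p; rewrite comp_lfunE zero_lfunE !lfunE /= /step /=.
by rewrite mulrBl -!mulrA ext_in_sq !mulr0 -scalerAl subr0 subrr.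
Qed.

(* The contraction is the second component of the representation of E on      *)
(* E * E in which v acts by (x, y) |-> (x v, f v x - y v), an operator of     *)
(* square 0.                                                                  *)
Lemma contraction :
  exists d : {linear E -> E}, forall x v, d (x * ι v) = f v *: x - d x * ι v.
Proof.
have [h hE] := ext_univ op_sq.
pose app (g : 'End(EE)) : EE := g (1, 0).
(* Products in [lfun_algType] compose from left to right, so the last factor acts last. *)
have hM x v : app (h (x * ι v)) = step v (app (h x)).
  by rewrite rmorphM /= hE /app comp_lfunE lfunE.
pose d x := (app (h x)).2.
have d_lin : linear d.
  by move=> a x y; rewrite /d /app linearP add_lfunE scale_lfunE.
pose p x := (app (h x)).1.
have p_lin : linear p.
  by move=> a x y; rewrite /p /app linearP add_lfunE scale_lfunE.
pose dL : {linear E -> E} := HB.pack d (GRing.isLinear.Build F E E _ d d_lin).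
pose pL : {linear E -> E} := HB.pack p (GRing.isLinear.Build F E E _ p p_lin).
(* The first component of the action on (1, 0) is the identity: the solutions of [p x = x] form a
   subspace, to which [ext_subspace_full] applies. *)
have pE x : p x = x.
  suff: x \in lker (linfun pL - \1)%VF.
    by move/eqlfunP; rewrite [RHS]id_lfunE (lfunE pL).
  set X := lker _; suff -> : X = fullv by apply: memvf.
  apply: ext_subspace_full.
    apply/eqlfunP; rewrite [RHS]id_lfunE (lfunE pL) /= /p.
    by rewrite rmorph1; apply: (congr1 fst (id_lfunE _)).
  apply/prodvP => y _ /eqlfunP yE /ext_subP[v _ ->]; move: yE.
  rewrite [X in _ = X -> _]id_lfunE (lfunE pL) /= => yE.
  by apply/eqlfunP; rewrite [RHS]id_lfunE (lfunE pL) /= /p hM /= -/(p y) yE.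
exists dL => x v; rewrite /= /d hM /=; congr (_ *: _ - _).
exact: pE.
Qed.

End Contraction.

Section Ideals.

Variables (F : fieldType) (V : vectType F).
Local Notation E := (exterior V).
Local Notation ι := (@ext_in F V).
Local Notation Λ j := (ext_pow {:V} (Posz j)).
Local Notation ideal_deg U j := (ideal_part (ext_ideal U) (Posz j)).
Implicit Types (U W : {vspace V}) (v w : V) (x y : E).

Lemma ext_idealS U W : (U <= W)%VS -> (ext_ideal U <= ext_ideal W)%VS.
Proof. by move=> sUW; apply: prodvSl; apply: ext_subS. Qed.

Lemma ext_idealM U (X : {vspace E}) : (ext_ideal U * X <= ext_ideal U)%VS.
Proof. by rewrite /ext_ideal -prodvA prodvSr ?subvf. Qed.

Lemma scalar_separating W v : v \notin W ->
  exists2 f : {scalar V}, {in W, forall w, f w = 0} & f v = 1.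
Proof.
move=> nWv; have v0 : v != 0 by apply: contraNneq nWv => ->; rewrite mem0v.
have dis : (<[v]> :&: W = 0)%VS.
  apply/eqP; rewrite -subv0; apply/subvP => _ /memv_capP[/vlineP[c ->]].
  have [->|c0 cv] := eqVneq c 0; first by rewrite scale0r !mem0v.
  by case/negP: nWv; rewrite -(scalerK c0 v) memvZ.
exists (coord [tuple v] ord0 \o daddv_pi <[v]> W) => /= [w Ww|].
  have := daddv_pi_add dis (subvP (addvSr <[v]> W) _ Ww).
  rewrite [X in _ + X](daddv_pi_id _ Ww) 1?capvC //.
  by move/(canRL (addrK _)) => ->; rewrite subrr linear0.
rewrite daddv_pi_id ?memv_line //.
by have := coord_free ord0 ord0 (etrans (seq1_free v) v0); rewrite /= => ->.
Qed.

(** Let d be the contraction by a form with f = 0 on W and f v = 1. It maps (W) to itself, and d (x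
    v) = x - d x v; hence x is d x v modulo (W). *)
Lemma ext_ideal_colon W v x :
  v \notin W -> x * ι v \in ext_ideal W -> x \in ext_ideal (W + <[v]>).
Proof.
case/scalar_separating => f fW fv Wxv; have [d dE] := contraction f.
have dW : (ext_ideal W <= linfun d @^-1: ext_ideal W)%VS.
  rewrite ext_ideal_right; apply/prodvP => y _ _ /ext_subP[w Ww ->].
  rewrite -memv_preim lfunE /= dE fW // scale0r sub0r memvN.
  by rewrite memv_mul ?memvf ?mem_ext_sub.
have := subvP dW _ Wxv; rewrite -memv_preim lfunE /= dE fv scale1r => dxv.
rewrite -(subrK (d x * ι v) x); apply: memvD.
  by apply: subvP dxv; apply: ext_idealS; apply: addvSl.
rewrite ext_ideal_right memv_mul ?memvf // mem_ext_sub //.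
by rewrite (subvP (addvSr _ _)) ?memv_line.
Qed.

(** The generators have degree 1, so in a homogeneous element of degree j + 1 only the cofactors of
    degree j survive. *)
Lemma ext_ideal_degS U (j : nat) : ideal_deg U j.+1 = (Λ j * ext_sub U)%VS.
Proof.
apply/eqP; rewrite eqEsubv subv_cap ext_sub_pow1 andbT; apply/andP; split; last first.
  by rewrite ext_ideal_right prodvSl ?subvf.
apply/subvP => x /memv_capP[]; rewrite ext_ideal_right -ext_grading big_distrl /=.
case/memv_sumP => y yj xE xdeg.
have yd i : y i \in Λ i.+1.
  by apply: (subvP (ext_sub_pow1 U i)); apply: yj.
suff -> : x = \sum_(i < (\dim {:V}).+1 | (i : nat) == j) y i.
  by apply: memv_suml => i /eqP <-; apply: yj.
apply/ffunP => S; rewrite sum_ffunE.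
have [cS|cS] := eqVneq #|S| j.+1.
  rewrite xE sum_ffunE (bigID (fun i : 'I__ => (i : nat) == j)) /=.
  rewrite [X in _ + X]big1 ?addr0 // => i nij.
  by apply: ext_pow_coef0 (yd i) _; rewrite cS eqSS eq_sym.
rewrite (ext_pow_coef0 xdeg cS) big1 // => i /eqP ij.
by apply: ext_pow_coef0 (yd i) _; rewrite ij.
Qed.

Lemma ext_ideal_deg0 U : ideal_deg U 0 = 0%VS.
Proof.
apply/eqP; rewrite -subv0; apply/subvP => x /memv_capP[].
rewrite ext_ideal_right -ext_grading big_distrl /= => /memv_sumP[y yj xE].
rewrite expv0 => /vlineP[c xc].
suff: x set0 = 0.
  by rewrite xc extZ -ext_mono0 ext_monoE eqxx mulr1 => ->; rewrite scale0r mem0v.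
rewrite xE sum_ffunE big1 // => i _.
have yi : y i \in Λ i.+1 by apply: (subvP (ext_sub_pow1 U i)); apply: yj.
by apply: ext_pow_coef0 yi _; rewrite cards0.
Qed.

(** The projection onto U along W extends to an algebra endomorphism, which fixes the powers of U
    and kills (W). *)
Lemma ext_pow_capv_ideal U W (j : nat) :
  (U :&: W = 0)%VS -> (ext_pow U j :&: ext_ideal W = 0)%VS.
Proof.
move=> UW0; pose f : {linear V -> E} := ι \o daddv_pi U W.
have f_sq v : f v * f v = 0 by apply: ext_in_sq.
have [h hE] := ext_univ f_sq.
have hU : (ext_pow U j <= lker (linfun h - \1)%VF)%VS.
  rewrite /=; elim: j => [|j IH].
    by rewrite expv0 -memvE; apply/eqlfunP; rewrite [RHS]id_lfunE (lfunE h) rmorph1.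
  rewrite expvSr; apply/prodvP => x _ /(subvP IH)/eqlfunP xh /ext_subP[v Uv ->].
  move: xh; rewrite [X in _ = X -> _]id_lfunE (lfunE h) /= => xh.
  apply/eqlfunP; rewrite [RHS]id_lfunE (lfunE h) /= rmorphM /= xh hE /=.
  by rewrite daddv_pi_id.
have hW : (ext_ideal W <= lker (linfun h))%VS.
  apply/prodvP => _ x /ext_subP[w Ww ->] _; rewrite memv_ker (lfunE h) /= rmorphM.
  rewrite /= hE /=; have := daddv_pi_add UW0 (subvP (addvSr U W) _ Ww).
  rewrite [X in _ + X](daddv_pi_id _ Ww) 1?capvC //.
  by move/(canRL (addrK _)) => ->; rewrite subrr linear0 mul0r.
apply/eqP; rewrite -subv0; apply/subvP => x /memv_capP[/(subvP hU)/eqlfunP].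
rewrite [X in _ = X -> _]id_lfunE => xh /(subvP hW).
by rewrite memv_ker memv0 xh.
Qed.

(** The power is the image of the one formed in the exterior algebra of U itself, where no set of j
    basis indices exists. *)
Lemma ext_pow_gt_dim U (j : nat) : (\dim U < j)%N -> ext_pow U j = 0%VS.
Proof.
move=> ltUj; pose f : {linear subvs_of U -> E} := ι \o vsval.
have f_sq (v : subvs_of U) : f v * f v = 0 by apply: ext_in_sq.
have [h hE] := ext_univ f_sq.
have hU k : (ext_pow U (Posz k) <= linfun h @: ext_pow {:subvs_of U} (Posz k))%VS.
  rewrite /=; elim: k => [|k IH].
    rewrite !expv0 -memvE; apply/memv_imgP.
    by exists 1; rewrite ?memv_line // (lfunE h) /= rmorph1.
  rewrite !expvSr; apply/prodvP => x _ /(subvP IH)/memv_imgP[y yk ->] /ext_subP[v Uv ->].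
  have -> : ι v = linfun h (ext_in (vsproj U v)) by rewrite (lfunE h) /= hE /= vsprojK.
  apply/memv_imgP; exists (y * ext_in (vsproj U v)).
    by rewrite memv_mul // mem_ext_sub ?memvf.
  by rewrite !(lfunE h) /= rmorphM.
apply/eqP; rewrite -subv0; apply: subv_trans (hU j) _.
suff -> : ext_pow {:subvs_of U} (Posz j) = 0%VS by rewrite limg0.
apply/eqP; rewrite -subv0; apply/subvP => x; rewrite (memv_ext_pow j) => /forallP xj.
rewrite memv0; apply/eqP/ffunP => S; rewrite ffunE.
have := xj S; case: eqP => //= _ /eqP cS.
have := max_card S; rewrite cS card_ord.
have dimU : \dim {:subvs_of U} = \dim U := dimvf _.
by move/leq_trans/(_ (eq_leq dimU)); rewrite leqNgt ltUj.
Qed.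

(** For v nonzero in both subspaces, x /\ v lies above the top degree of U, so it vanishes;
    [ext_ideal_colon] at the zero subspace then gives x in (<v>). *)
Lemma ext_pow_dim_ideal U W x :
  (U :&: W != 0)%VS -> x \in ext_pow U (\dim U) -> x \in ext_ideal W.
Proof.
rewrite -vpick0 => v0 xU; have := memv_pick (U :&: W)%VS.
set v := vpick _ in v0 * => /memv_capP[Uv Wv].
have sub : (0 + <[v]> <= W)%VS by rewrite add0v -memvE.
apply: (subvP (ext_idealS sub)); apply: ext_ideal_colon; first by rewrite memv0.
have : x * ι v \in ext_pow U (Posz (\dim U).+1).
  by rewrite /= expvSr memv_mul ?mem_ext_sub.
by rewrite ext_pow_gt_dim // memv0 => /eqP ->; apply: mem0v.
Qed.

End Ideals.

(** * Binomials, dimensions and generic vectors *)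

Lemma binzS (a : nat) (b : int) : binz a.+1 b = (binz a b + binz a (b - 1))%N.
Proof.
case: b => [[|c]|c]; first by rewrite /= !bin0.
  by rewrite (_ : c.+1%:Z - 1 = c) ?binS //; lia.
by rewrite (_ : Negz c - 1 = Negz c.+1) //; lia.
Qed.

Lemma binz0 (b : int) : binz 0 b = (b == 0).
Proof. by case: b => [[|c]|c]. Qed.

Lemma dim_add_line (K : fieldType) (V : vectType K) (U : {vspace V}) v :
  v \notin U -> \dim (U + <[v]>) = (\dim U).+1.
Proof.
move=> Uv; rewrite dimv_disjoint_sum.
  rewrite dim_vline; case: eqP Uv => [->|_ _]; last by rewrite addn1.
  by rewrite mem0v.
apply/eqP; rewrite -subv0; apply/subvP => x /memv_capP[Ux /vlineP[c xE]].
have [c0|c0] := eqVneq c 0; first by rewrite xE c0 scale0r mem0v.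
by case/negP: Uv; rewrite -(scalerK c0 v) -xE memvZ.
Qed.

Section Avoidance.

Variables (K : fieldType) (V : vectType K).

(** Each [w] rules out at most one entry of [l], so a longer list is not exhausted. *)
Lemma pigeonhole_avoid (T U : eqType) (bad : U -> pred T) (s : seq U) (l : seq T) :
  {in s, forall w, {in bad w &, forall a b, a = b}} -> uniq l ->
  (size s < size l)%N -> exists2 a, a \in l & all (fun w => ~~ bad w a) s.
Proof.
elim: s l => [|w s IH] l inj Ul /=.
  by case: l Ul => // a l _ _; exists a => //; rewrite mem_head.
move=> lt; have le1 : (count (bad w) l <= 1)%N.
  rewrite -size_filter; have := filter_uniq (bad w) Ul.
  have sub a : a \in [seq x <- l | bad w x] -> bad w a.
    by rewrite mem_filter => /andP[].
  case: filter sub => [|a [|b r]] //= sub; rewrite inE negb_or => /andP[/andP[/eqP]].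
  by case; apply: (inj w); rewrite ?mem_head //; apply: sub; rewrite !inE eqxx ?orbT.
have [|||a] := IH [seq x <- l | ~~ bad w x].
- by move=> z zs; apply: inj; rewrite inE zs orbT.
- exact: filter_uniq.
- rewrite size_filter -[count _ l]/(count (predC (bad w)) l).
  by have := count_predC (bad w) l; move: lt; rewrite /=; lia.
by rewrite mem_filter => /andP[na al] sa; exists a => //; rewrite na.
Qed.

(** The injective [c] expresses that K is infinite. If v avoids the tail and x avoids the head W, a
    subspace meeting the family v + c_i x twice contains both x and v, so each member of the list
    excludes at most one i. *)
Lemma avoid_subspaces (c : nat -> K) (s : seq {vspace V}) :
  injective c -> {in s, forall W, W != fullv} ->
  exists v, all (fun W : {vspace V} => v \notin W) s.
Proof.
move=> c_inj; elim: s => [|W s IH] proper; first by exists 0.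
have [|v vs] := IH; first by move=> U Us; apply: proper; rewrite inE Us orbT.
have [vW|vW] := boolP (v \in W); last by exists v; rewrite /= vW.
have [x _ xW] : exists2 x, x \in fullv & x \notin W.
  apply/subvPn; have := proper W (mem_head _ _).
  by rewrite eqEsubv subvf.
pose bad (U : {vspace V}) i := v + c i *: x \in U.
have diff (U : {vspace V}) i j : bad U i -> bad U j -> i != j -> (x \in U) && (v \in U).
  move=> Ui Uj nij; have Ux : x \in U.
    have := memvB Ui Uj; rewrite opprD addrACA subrr add0r -scalerBl => Ux.
    have cij : c i - c j != 0 by rewrite subr_eq0 (inj_eq c_inj).
    by rewrite -(scalerK cij x) memvZ.
  by rewrite Ux -(addrK (c i *: x) v) memvB // memvZ.
have [|||i _ iW] := @pigeonhole_avoid _ _ bad (W :: s) (iota 0 (size s).+2).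
- move=> U; rewrite inE => /orP[/eqP-> | Us] i j Ui Uj; apply/eqP; apply/idPn.
    by case/(diff _ _ _ Ui Uj)/andP; rewrite (negPf xW).
  by case/(diff _ _ _ Ui Uj)/andP => _; rewrite (negPf (allP vs _ Us)).
- exact: iota_uniq.
- by rewrite size_iota.
by exists (v + c i *: x).
Qed.

(** Rank-nullity on D and on the part of D sent into T: both have the same kernel, and the second
    has image [T :&: f @: D]. *)
Lemma dim_add_limg (W : vectType K) (f : 'Hom(V, W)) (T : {vspace W}) (D : {vspace V}) :
  (\dim (T + f @: D) + \dim (D :&: f @^-1: T) = \dim T + \dim D)%N.
Proof.
have TD : (f @: (D :&: f @^-1: T) = T :&: f @: D)%VS.
  apply/eqP; rewrite eqEsubv; apply/andP; split.
    rewrite subv_cap limgS ?capvSl // andbT; apply/subvP => _ /memv_imgP[x xD ->].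
    by move: xD; rewrite memv_cap -memv_preim => /andP[].
  apply/subvP => y /memv_capP[Ty /memv_imgP[x Dx yE]]; rewrite yE memv_img //.
  by rewrite memv_cap Dx -memv_preim -yE.
have := limg_ker_dim f (D :&: f @^-1: T); rewrite TD.
have -> : (D :&: f @^-1: T :&: lker f = D :&: lker f)%VS.
  apply/eqP; rewrite eqEsubv capvS ?capvSl //=; apply/subvP => x /memv_capP[Dx fx].
  rewrite !memv_cap Dx fx -memv_preim; move: fx; rewrite memv_ker => /eqP ->.
  by rewrite mem0v.
have := limg_ker_dim f D; have := dimv_sum_cap T (f @: D); lia.
Qed.


End Avoidance.

(** * The induction over an infinite field *)

Section Core.

Variables (K : fieldType) (V : vectType K) (m : nat).
Variables (A B : 'I_m -> {vspace V}) (u : 'I_m -> exterior V).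
Local Notation n := (\dim {:V}).
Local Notation E := (exterior V).
Local Notation ι := (@ext_in K V).
Local Notation Λ j := (ext_pow {:V} (Posz j)).
Local Notation ideal_deg U j := (ideal_part (ext_ideal U) (Posz j)).
Local Notation a i := (\dim (A i)).
Local Notation b i := (\dim (B i)).
Implicit Types (I : {set 'I_m}) (L : {vspace V}) (M : nat -> {vspace E}).

(* The ideal M / (L) of the exterior algebra of V / L, given by its graded    *)
(* pieces, is sandwiched as in the theorem for the pairs with index in I.     *)
Definition sandwiched I L M : Prop :=
  [/\ forall j, (M j <= Λ j)%VS,
      forall j, (M j * ext_sub {:V} <= M j.+1)%VS,
      forall j, (ideal_deg L j <= M j)%VS
    & forall i, i \in I ->
      [/\ ((A i + B i) :&: L = 0)%VS,
          (<[u i]> * ext_sub (B i) <= M (a i).+1)%VS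
        & forall j, (M j <= ext_ideal (B i + L))%VS]].

(** For sandwiched [M], the dimension of the degree-j piece of M / (L). *)
Definition reldim L M (j : nat) : int :=
  (\dim (M j))%:Z - (\dim (ideal_deg L j))%:Z.

Hypothesis AB0 : forall i, (A i :&: B i = 0)%VS.
Hypothesis u_in : forall i, u i \in ext_pow (A i) (a i).
Hypothesis u_neq0 : forall i, u i != 0.
Hypothesis u_mem : forall i j, i != j -> u i \in ext_ideal (B j).

Lemma dim_add3 I L M i : sandwiched I L M -> i \in I ->
  (\dim (A i + B i + L) = a i + b i + \dim L)%N.
Proof.
case=> _ _ _ MI /MI[ABL _ _]; rewrite dimv_disjoint_sum //; congr (_ + _)%N.
exact: dimv_disjoint_sum.
Qed.

Lemma u_degree i : u i \in Λ (a i).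
Proof. exact: (subvP (ext_pow_sub (A i) (a i)) _ (u_in i)). Qed.

(** A_i meets B_i + L trivially, so by [ext_pow_capv_ideal] a nonzero u_i is not in (B_i + L). *)
Lemma u_notin I L M i j : sandwiched I L M -> i \in I -> u i \notin M j.
Proof.
case=> _ _ _ MI /MI[ABL _ Mle]; apply: contra (u_neq0 i) => /(subvP (Mle j)) uBL.
rewrite -memv0 -(ext_pow_capv_ideal (a i) (U := A i) (W := (B i + L)%VS)).
  by rewrite memv_cap u_in.
apply/eqP; rewrite -subv0; apply/subvP => x /memv_capP[Ax /memv_addP[y By [z Lz xE]]].
have z0 : z = 0.
  apply/eqP; rewrite -memv0 -ABL memv_cap Lz andbT.
  have -> : z = x - y by rewrite xE addrC addKr.
  by rewrite memvB // ?(subvP (addvSl _ _) _ Ax) ?(subvP (addvSr _ _) _ By).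
by rewrite -(AB0 i) memv_cap Ax xE z0 addr0.
Qed.

Lemma sandwichedS I I' L M : I' \subset I -> sandwiched I L M -> sandwiched I' L M.
Proof. by move=> sI [? ? ? MI]; split=> // i /(subsetP sI)/MI. Qed.

(** Here V = A_i + B_i + L, and multiplying u_i by a vector of these summands gives respectively 0,
    an element of M, and an element of (L), which M contains. So adjoining u_i still gives an ideal.
    The index i must leave because u_i is not in (B_i + L). *)
Lemma sandwiched_line I L M i :
  sandwiched I L M -> i \in I -> (a i + b i + \dim L)%N = n ->
  sandwiched (I :\ i) L (fun j => M j + if j == a i then <[u i]> else 0)%VS.
Proof.
move=> sM Ii dimL; have := dim_add3 sM Ii; rewrite dimL => /eqP full.
have {}full : (A i + B i + L = fullv)%VS.
  by apply/eqP; rewrite eqEdim subvf (eqP full) leqnn.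
have [Mdeg MV LM MI] := sM; have [_ uB _] := MI i Ii; split.
- move=> j; rewrite subv_add Mdeg; case: eqP => [->|_]; last exact: sub0v.
  by rewrite -memvE u_degree.
- move=> j; rewrite prodvDl subv_add (subv_trans (MV j) (addvSl _ _)).
  case: eqP => [->|_]; last by rewrite prod0v sub0v.
  apply: subv_trans (addvSl _ _); rewrite -full !ext_subD !prodvDr !subv_add.
  apply/andP; split; last first.
    apply: subv_trans (LM _); rewrite ext_ideal_degS prodvSl //.
    by rewrite -memvE u_degree.
  rewrite uB andbT; apply: subv_trans (sub0v _).
  rewrite -(ext_pow_gt_dim (ltnSn (a i))) /= expvSr prodvSl //.
  by rewrite -memvE u_in.
- by move=> j; apply: subv_trans (LM j) (addvSl _ _).
- move=> l; rewrite !inE => /andP[nli Il]; have [ABL uBl Mle] := MI l Il.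
  split=> // [|j]; first exact: subv_trans uBl (addvSl _ _).
  rewrite subv_add Mle; case: ifP => _; last exact: sub0v.
  rewrite -memvE; rewrite eq_sym in nli.
  exact: (subvP (ext_idealS (addvSl _ _)) _ (u_mem nli)).
Qed.

(** * The two ideals obtained from a generic vector *)

Section Generic.

Variables (I : {set 'I_m}) (L : {vspace V}) (M : nat -> {vspace E}) (v : V).
Hypothesis sM : sandwiched I L M.
Hypothesis Lv : v \notin L.
Hypothesis ABLv : forall i, i \in I -> v \notin (A i + B i + L)%VS.

Let L' := (L + <[v]>)%VS.
(** [sum_pieces] and [colon_pieces] represent M1 and M2, as ideals containing (L'). *)
Definition sum_pieces (j : nat) := (M j + ideal_deg L' j)%VS.
Definition colon_pieces (j : nat) := (Λ j :&: amulr (ι v) @^-1: M j.+1)%VS.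

Let AB_L' i : i \in I -> ((A i + B i) :&: L' = 0)%VS.
Proof.
move=> Ii; have [_ _ _ /(_ i Ii)[ABL _ _]] := sM.
apply/eqP; rewrite -dimv_eq0; have := dimv_sum_cap (A i + B i)%VS L'.
rewrite /L' addvA !dim_add_line ?ABLv // (dimv_disjoint_sum ABL); lia.
Qed.

Let notin_BL i : i \in I -> v \notin (B i + L)%VS.
Proof.
by move/ABLv; apply: contra; apply/subvP; rewrite -addvA addvSr.
Qed.

Lemma ideal_deg_line (j : nat) :
  ideal_deg L' j.+1 = (ideal_deg L j.+1 + amulr (ι v) @: Λ j)%VS.
Proof. by rewrite !ext_ideal_degS /L' ext_subD prodvDr ext_sub_line limg_amulr. Qed.

(** One inclusion is [ext_ideal_colon], the other v /\ v = 0. With [ideal_deg_line] this says that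
    both constructions send (L) to (L'). *)
Lemma ideal_deg_colon (j : nat) :
  ideal_deg L' j = (Λ j :&: amulr (ι v) @^-1: ideal_deg L j.+1)%VS.
Proof.
apply/eqP; rewrite eqEsubv; apply/andP; split; apply/subvP => x; last first.
  case/memv_capP => xj; rewrite -memv_preim lfunE /= => /memv_capP[xvL _].
  by rewrite memv_cap xj ext_ideal_colon.
case/memv_capP => xL' xj; rewrite memv_cap xj -memv_preim lfunE /=.
rewrite memv_cap andbC; apply/andP; split.
  by rewrite -ext_powS memv_mul // mem_ext_sub ?memvf.
have sub : (ext_ideal L' * <[ι v]> <= ext_ideal L)%VS.
  rewrite /ext_ideal /L' ext_subD prodvDl prodvDl subv_add -/(ext_ideal L).
  rewrite ext_idealM /= ext_sub_line.
  have -> : (<[ι v]> * {:E} = {:E} * <[ι v]>)%VS.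
    by rewrite -ext_sub_line -ext_ideal_right.
  by rewrite -prodvA prodv_line ext_in_sq prodv0 sub0v.
by apply: (subvP sub); rewrite memv_mul ?memv_line.
Qed.

Lemma sub_colon_pieces (j : nat) : (M j <= colon_pieces j)%VS.
Proof.
have [Mdeg MV _ _] := sM; rewrite subv_cap Mdeg; apply/subvP => x Mx.
by rewrite -memv_preim lfunE (subvP (MV j)) // memv_mul ?mem_ext_sub ?memvf.
Qed.

Lemma sum_sub_colon (j : nat) : (sum_pieces j <= colon_pieces j)%VS.
Proof.
rewrite subv_add sub_colon_pieces ideal_deg_colon capvS //.
by apply: lpreimS; have [] := sM.
Qed.

Lemma sandwiched_sum : sandwiched I L' sum_pieces.
Proof.
have [Mdeg MV LM MI] := sM; split.
- by move=> j; rewrite subv_add Mdeg capvSr.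
- move=> j; rewrite prodvDl addvS // subv_cap; apply/andP; split.
    by apply: subv_trans (ext_idealM L' (ext_sub {:V})); rewrite prodvSl ?capvSl.
  by rewrite -ext_powS prodvSl ?capvSr.
- by move=> j; apply: addvSr.
- move=> i Ii; have [ABL uB Mle] := MI i Ii; split=> [||j]; first exact: AB_L'.
    exact: subv_trans uB (addvSl _ _).
  rewrite subv_add (subv_trans (Mle j)) ?ext_idealS ?addvS ?addvSl //=.
  by apply: subv_trans (capvSl _ _) _; rewrite ext_idealS ?addvSr.
Qed.

(** The upper bound is [ext_ideal_colon] for B_i + L, which does not contain v. *)
Lemma sandwiched_colon : sandwiched I L' colon_pieces.
Proof.
have [Mdeg MV LM MI] := sM; split.
- by move=> j; apply: capvSl.
- move=> j; apply/prodvP => x y /memv_capP[xj]; rewrite -memv_preim lfunE /= => xvM.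
  case/ext_subP => w _ ->{y}; rewrite memv_cap -ext_powS memv_mul ?mem_ext_sub ?memvf //=.
  rewrite -memv_preim lfunE /= -mulrA ext_inC mulrN memvN mulrA.
  by rewrite (subvP (MV _)) // memv_mul ?mem_ext_sub ?memvf.
- by move=> j; apply: subv_trans (sum_sub_colon j); apply: addvSr.
- move=> i Ii; have [ABL uB Mle] := MI i Ii; split=> [||j]; first exact: AB_L'.
    exact: subv_trans uB (sub_colon_pieces _).
  apply/subvP => x /memv_capP[_]; rewrite -memv_preim lfunE /= => /(subvP (Mle _)).
  by rewrite /L' addvA; apply: ext_ideal_colon; apply: notin_BL.
Qed.

(** Apply [dim_add_limg] to multiplication by v on degree j, once with target M and once with target
    (L); in the difference the dimension of the full degree-j part cancels. *)
Lemma reldim_split (j : nat) :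
  reldim L M j.+1 = reldim L' sum_pieces j.+1 + reldim L' colon_pieces j.
Proof.
have [_ _ LM _] := sM.
have eM : sum_pieces j.+1 = (M j.+1 + amulr (ι v) @: Λ j)%VS.
  by rewrite /sum_pieces ideal_deg_line addvA (addv_idPl (LM _)).
have arith (s c p q s' c' p' : nat) : (s + c = p + q)%N -> (s' + c' = p' + q)%N ->
  p%:Z - p'%:Z = (s%:Z - s'%:Z) + (c%:Z - c'%:Z) by lia.
have := dim_add_limg (amulr (ι v)) (M j.+1) (Λ j); rewrite -eM => dM.
have := dim_add_limg (amulr (ι v)) (ideal_deg L j.+1) (Λ j).
rewrite -ideal_deg_line -ideal_deg_colon => dL.
exact: arith dM dL.
Qed.

Lemma reldim0 : reldim L M 0 = reldim L' sum_pieces 0.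
Proof. by rewrite /reldim /sum_pieces !ext_ideal_deg0 addv0. Qed.

End Generic.

Lemma reldim_ge0 I L M (j : nat) : sandwiched I L M -> 0 <= reldim L M j.
Proof. by case=> _ _ LM _; rewrite subr_ge0 lez_nat dimvS. Qed.

(** The bound at degree k + 1, for an ambient space V / L of dimension d. *)
Let lambda_ge (d : nat) I L M (k : nat) : Prop :=
  (\sum_(i in I) b i * binz (d - a i - b i) (k%:Z - (a i)%:Z))%N%:Z
    <= k.+1%:Z * reldim L M k.+1 - (d%:Z - k%:Z) * reldim L M k.

Lemma lambda_ge_reduce (d : nat) L (k : nat) : (\dim L + d)%N = n ->
  (forall I M, sandwiched I L M -> {in I, forall i, (a i + b i < d)%N} ->
     lambda_ge d I L M k) ->
  forall I M, sandwiched I L M -> lambda_ge d I L M k.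
Proof.
move=> dimL base I; move: {2}#|I| (leqnn #|I|) => N.
elim: N I => [|N IHN] I cI M sM.
  move: cI; rewrite leqn0 cards_eq0 => /eqP I0; apply: base => // i.
  by rewrite I0 inE.
have [i /andP[Ii full]|small] := pickP [pred i in I | ~~ (a i + b i < d)%N]; last first.
  by apply: base => // i Ii; move/(_ i): small; rewrite /= Ii => /negbFE.
have dABL := dim_add3 sM Ii; have := dimvS (subvf (A i + B i + L)%VS).
rewrite dABL => abn; have {full}abd : (a i + b i = d)%N by move: full; lia.
have cI' : (#|I :\ i| <= N)%N by move: cI; rewrite (cardsD1 i) Ii.
have sM' : sandwiched (I :\ i) L M by apply: sandwichedS sM; apply: subsetDl.
rewrite /lambda_ge (big_setD1 i Ii) /= -subnDA abd subnn binz0 subr_eq0 eqz_nat.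
(* The binomial of a full pair is 1 if k = a_i and 0 otherwise. In the first case adjoining u_i
   lowers the right side by d - k = b_i, exactly its term. *)
have [kai|nka] := eqVneq k (a i); last by rewrite muln0 add0n; apply: IHN.
have abL : (a i + b i + \dim L = n)%N by lia.
have := IHN _ cI' _ (sandwiched_line sM Ii abL); rewrite /lambda_ge /reldim -kai.
rewrite eqxx eqn_leq ltnn /= addv0 dim_add_line ?(u_notin _ sM) //.
rewrite muln1; have -> : d%:Z = k%:Z + (b i)%:Z by lia.
set S := (\sum_(_ in _) _)%N; move: S => S; lia.
Qed.

(** Write s and c for the relative dimensions of M1 and M2. In dimension d + 1 the right side is
    [(k+1) s_(k+1) - (d-k) s_k] + [k c_k - (d-k+1) c_(k-1)] + (c_k - s_k). The brackets are bounded
    by induction, at k and k - 1, and c_k >= s_k; Pascal's rule adds the bounds. *)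
Lemma sandwiched_lambda (c : nat -> K) (d : nat) I L M (k : nat) :
  injective c -> (\dim L + d)%N = n -> sandwiched I L M -> lambda_ge d I L M k.
Proof.
move=> c_inj; elim: d I L M k => [|d IHd] I L M k dimL; last first.
  move: I M; apply: lambda_ge_reduce => // I M sM small.
  have [|v] := avoid_subspaces (s := L :: [seq (A i + B i + L)%VS | i <- enum I]) c_inj.
    move=> W; rewrite inE => /orP[/eqP->|/mapP[i]].
      by apply: contraTneq (leqnn n) => Lf; move: dimL; rewrite Lf; lia.
    rewrite mem_enum => Ii ->; apply: contraTneq (small i Ii) => ABLf.
    by have := dim_add3 sM Ii; rewrite ABLf; lia.
  case/andP=> Lv /allP avoid.
  have ABLv i : i \in I -> v \notin (A i + B i + L)%VS.
    by move=> Ii; apply: avoid; apply: map_f; rewrite mem_enum.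
  have dimL' : (\dim (L + <[v]>) + d)%N = n by rewrite dim_add_line // addSnnS.
  have sS := sandwiched_sum sM Lv ABLv; have sC := sandwiched_colon sM Lv ABLv.
  have sumS : (\sum_(i in I) b i * binz (d.+1 - a i - b i) (k%:Z - (a i)%:Z) =
      \sum_(i in I) b i * binz (d - a i - b i) (k%:Z - (a i)%:Z)
      + \sum_(i in I) b i * binz (d - a i - b i) (k%:Z - (a i)%:Z - 1))%N.
    rewrite -big_split /=; apply: eq_bigr => i /small ltd.
    by rewrite -mulnDr -binzS; congr (_ * binz _ _)%N; lia.
  have le12 : reldim (L + <[v]>) (sum_pieces L M v) k
      <= reldim (L + <[v]>) (colon_pieces M v) k.
    by rewrite lerB // lez_nat dimvS // (sum_sub_colon sM).
  rewrite /lambda_ge sumS (reldim_split sM Lv).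
  have := IHd _ _ _ k dimL' sS; rewrite /lambda_ge.
  set S1 := (\sum_(i in I) _)%N; move: S1 => S1.
  (* At k = 0 the second bracket is absent, and its binomials have negative lower index. *)
  case: k sumS le12 => [|k] sumS le12.
    rewrite (reldim0 L M v) big1 => [|i Ii]; last first.
      by rewrite (_ : _ - 1 = Negz (a i)) ?muln0 //; lia.
    move: le12; set X := reldim _ _ 0; set Y := reldim _ _ 0.
    by move: X Y (reldim _ _ 1) => X Y Z; lia.
  have -> : (\sum_(i in I) b i * binz (d - a i - b i) (k.+1%:Z - (a i)%:Z - 1) =
      \sum_(i in I) b i * binz (d - a i - b i) (k%:Z - (a i)%:Z))%N.
    by apply: eq_bigr => i _; congr (_ * binz _ _)%N; lia.
  have := IHd _ _ _ k dimL' sC; rewrite /lambda_ge (reldim_split sM Lv).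
  set S2 := (\sum_(i in I) _)%N; move: S2 => S2.
  move: le12; do 4 move: (reldim _ _ _) => ?; lia.
(* For d = 0 no pair is left, and the right side is a nonnegative combination. *)
apply: lambda_ge_reduce => // {}I {}M sM small.
rewrite /lambda_ge big1 => [|i /small]; last by rewrite ltn0.
have := reldim_ge0 k sM; have := reldim_ge0 k.+1 sM; nia.
Qed.

End Core.

(** * Extension of scalars *)

Section RestrictScalars.

Variables (F K : fieldType) (s : {rmorphism F -> K}) (A : algType K).

(** The alias mentions [s] so that A can carry the F-algebra structure through [s], which makes it a
    possible target for [ext_univ]. *)
Definition restrict_scalars : Type := let _ := s in A.
Local Notation R := restrict_scalars.

HB.instance Definition _ := GRing.NzRing.copy R A.

Definition restrict_scale (a : F) (x : R) : R := (s a *: (x : A) : A).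

Fact restrict_scaleA a b x :
  restrict_scale a (restrict_scale b x) = restrict_scale (a * b) x.
Proof. by rewrite /restrict_scale scalerA rmorphM. Qed.

Fact restrict_scale1 : left_id 1 restrict_scale.
Proof. by move=> x; rewrite /restrict_scale rmorph1 scale1r. Qed.

Fact restrict_scaleDr : right_distributive restrict_scale +%R.
Proof. by move=> a x y; rewrite /restrict_scale scalerDr. Qed.

Fact restrict_scaleDl x : {morph restrict_scale^~ x : a b / a + b}.
Proof. by move=> a b; rewrite /restrict_scale rmorphD scalerDl. Qed.

HB.instance Definition _ := GRing.Zmodule_isLmodule.Build F R
  restrict_scaleA restrict_scale1 restrict_scaleDr restrict_scaleDl.

Fact restrict_scaleAl (a : F) (x y : R) : a *: (x * y) = (a *: x) * y.
Proof. exact: (@scalerAl K A). Qed.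

HB.instance Definition _ := GRing.Lmodule_isLalgebra.Build F R restrict_scaleAl.

Fact restrict_scaleAr (a : F) (x y : R) : a *: (x * y) = x * (a *: y).
Proof. exact: (@scalerAr K A). Qed.

HB.instance Definition _ := GRing.Lalgebra_isAlgebra.Build F R restrict_scaleAr.

End RestrictScalars.

Section ExtendScalars.

Variables (F K : fieldType) (s : {rmorphism F -> K}).
Variables (U : vectType F) (W : vectType K) (g : U -> W).
Hypothesis gD : {morph g : x y / x + y}.
Hypothesis gZ : forall a x, g (a *: x) = s a *: g x.
Implicit Types (X Y : {vspace U}) (Z : {vspace W}).

Definition extend X : {vspace W} := <<[seq g x | x <- vbasis X]>>%VS.

Lemma mem_extend X x : x \in X -> g x \in extend X.
Proof.
move=> Xx; rewrite (coord_vbasis Xx).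
have g0 : g 0 = 0 by rewrite -(scale0r 0) gZ rmorph0 scale0r.
rewrite (big_morph g gD g0); apply: memv_suml => i _; rewrite gZ memvZ //.
by rewrite memv_span // map_f // mem_nth // size_tuple.
Qed.

Lemma extend_subP X Z : reflect {in X, forall x, g x \in Z} (extend X <= Z)%VS.
Proof.
apply: (iffP idP) => [sXZ x Xx|XZ]; first exact: (subvP sXZ _ (mem_extend Xx)).
by apply/span_subvP => _ /mapP[x /vbasis_mem Xx ->]; apply: XZ.
Qed.

Lemma extendS X Y : (X <= Y)%VS -> (extend X <= extend Y)%VS.
Proof. by move/subvP=> sXY; apply/extend_subP => x /sXY; apply: mem_extend. Qed.

Lemma extendD X Y : (extend (X + Y) <= extend X + extend Y)%VS.
Proof.
apply/extend_subP => _ /memv_addP[x Xx [y Yy ->]].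
by rewrite gD memv_add ?mem_extend.
Qed.

Lemma dim_extend_le X : (\dim (extend X) <= \dim X)%N.
Proof. by apply: leq_trans (dim_span _) _; rewrite size_map size_tuple. Qed.

(** Dimensions cannot grow on X or on a complement, yet the two extensions together fill W, of the
    same dimension as U; so neither drops. *)
Lemma dim_extend X : extend fullv = fullv -> \dim {:U} = \dim {:W} ->
  \dim (extend X) = \dim X.
Proof.
move=> full dimUW; apply/eqP; rewrite eqn_leq dim_extend_le.
have := extendD X X^C; rewrite addv_complf full => /dimvS.
have := dimv_sum_cap (extend X) (extend X^C); have := dim_extend_le X^C.
have := dimvS (subvf X); rewrite dimv_compl; lia.
Qed.

Lemma semilinear_neq0 x : extend fullv = fullv -> \dim {:U} = \dim {:W} ->
  x != 0 -> g x != 0.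
Proof.
move=> full dimUW x0; have := dim_extend <[x]> full dimUW; rewrite dim_vline x0.
apply: contra_eq_neq => gx0; rewrite (_ : extend _ = 0%VS) ?dimv0 //.
apply/eqP; rewrite -subv0; apply/extend_subP => _ /vlineP[c ->].
by rewrite gZ gx0 scaler0 mem0v.
Qed.

End ExtendScalars.

Lemma dim_exterior (F : fieldType) (V : vectType F) :
  \dim {:exterior V} = (2 ^ \dim {:V})%N.
Proof.
rewrite dimvf -[LHS]/(#|{set 'I_(\dim {:V})}| * 1)%N muln1.
by rewrite -cardsT -powersetT card_powerset cardsT card_ord.
Qed.

Section ExtendExterior.

Variables (F K : fieldType) (s : {rmorphism F -> K}) (V : vectType F).
Local Notation VK := 'rV[K]_(\dim {:V}).
Local Notation Λ j := (ext_pow {:V} (Posz j)).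
Implicit Types (U : {vspace V}) (X Y : {vspace exterior V}).

(** The map from V to its scalar extension, realised as row vectors in the basis [vbasis {:V}]. *)
Definition extend_vec (v : V) : VK := \row_i s (coord (vbasis {:V}) i v).

Lemma extend_vecD : {morph extend_vec : v w / v + w}.
Proof. by move=> v w; apply/rowP => i; rewrite !mxE linearD rmorphD. Qed.

Lemma extend_vecZ a v : extend_vec (a *: v) = s a *: extend_vec v.
Proof. by apply/rowP => i; rewrite !mxE linearZ /= rmorphM. Qed.

Lemma dim_rV : \dim {:V} = \dim {:VK}.
Proof. by rewrite [RHS]dimvf [RHS]dim_matrix; apply/esym/mul1n. Qed.

Lemma extend_vec_full : extend extend_vec fullv = fullv.
Proof.
apply/eqP; rewrite eqEsubv subvf; apply/subvP => w _.
rewrite (row_sum_delta w); apply: memv_suml => i _; apply: memvZ.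
suff -> : delta_mx 0 i = extend_vec (vbasis {:V})`_i.
  by apply: (mem_extend extend_vecD extend_vecZ); apply: memvf.
apply/rowP => j; rewrite !mxE coord_free ?(basis_free (vbasisP _)) //.
by rewrite eqxx rmorph_nat eq_sym.
Qed.

Let ext_extend_vec (v : V) : restrict_scalars s (exterior VK) :=
  ext_in (extend_vec v).

Let ext_extend_vec_linear : linear ext_extend_vec.
Proof.
move=> a v w; rewrite /ext_extend_vec extend_vecD extend_vecZ.
by rewrite linearD linearZ.
Qed.

Lemma extend_exterior : exists g : exterior V -> exterior VK,
  [/\ {morph g : x y / x + y}, forall a x, g (a *: x) = s a *: g x,
      {morph g : x y / x * y}, g 1 = 1
    & forall v, g (ext_in v) = ext_in (extend_vec v)].
Proof.
pose f : {linear V -> restrict_scalars s (exterior VK)} :=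
  HB.pack ext_extend_vec
    (GRing.isLinear.Build F V (restrict_scalars s (exterior VK)) _ ext_extend_vec
       ext_extend_vec_linear).
have f_sq v : f v * f v = 0 by apply: (@ext_in_sq K VK).
have [h hE] := ext_univ f_sq; exists h; split=> //.
- exact: rmorphD.
- by move=> a x; apply: (linearZ_LR h a x).
- exact: rmorphM.
- exact: rmorph1.
Qed.

Variable g : exterior V -> exterior VK.
Hypothesis gD : {morph g : x y / x + y}.
Hypothesis gZ : forall a x, g (a *: x) = s a *: g x.
Hypothesis gM : {morph g : x y / x * y}.
Hypothesis g1 : g 1 = 1.
Hypothesis g_in : forall v, g (ext_in v) = ext_in (extend_vec v).

Lemma extendM X Y : (extend g X * extend g Y <= extend g (X * Y))%VS.
Proof.
apply/prodvP => x y Xx Yy.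
suff : (extend g X <= amulr y @^-1: extend g (X * Y))%VS.
  by move/subvP/(_ x Xx); rewrite -memv_preim lfunE.
apply/(extend_subP gD gZ) => {Xx}x Xx; rewrite -memv_preim lfunE /=.
suff : (extend g Y <= amull (g x) @^-1: extend g (X * Y))%VS.
  by move/subvP/(_ y Yy); rewrite -memv_preim lfunE.
apply/(extend_subP gD gZ) => {Yy}y Yy; rewrite -memv_preim lfunE /= -gM.
by apply: (mem_extend gD gZ); apply: memv_mul.
Qed.

Lemma extendM_sub X Y (Z : {vspace exterior VK}) :
  {in X & Y, forall x y, g x * g y \in Z} -> (extend g (X * Y) <= Z)%VS.
Proof.
(* Unlocking exposes the product as the span of products of basis vectors. *)
move=> XYZ; apply/(extend_subP gD gZ) => x; rewrite unlock => xXY.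
have g0 : g 0 = 0 by rewrite -(scale0r 0) gZ rmorph0 scale0r.
rewrite (coord_span (X := in_tuple _) xXY) (big_morph g gD g0).
apply: memv_suml => i _; rewrite gZ memvZ //.
have /allpairsP[[y z] /= [yX zY ->]] := mem_nth 0 (ltn_ord i).
by rewrite gM XYZ ?vbasis_mem.
Qed.

Lemma ext_sub_extend U : (ext_sub (extend extend_vec U) <= extend g (ext_sub U))%VS.
Proof.
suff : (extend extend_vec U <= linfun (@ext_in K VK) @^-1: extend g (ext_sub U))%VS.
  move=> /subvP sub; apply/subvP => _ /ext_subP[w /sub + ->].
  by rewrite -memv_preim lfunE.
apply/(extend_subP extend_vecD extend_vecZ) => v Uv.
rewrite -memv_preim lfunE /= -g_in; apply: (mem_extend gD gZ).
exact: mem_ext_sub.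
Qed.

Lemma g_ext_sub U x : x \in ext_sub U -> g x \in ext_sub (extend extend_vec U).
Proof.
case/ext_subP=> v Uv ->; rewrite g_in mem_ext_sub //.
exact: (mem_extend extend_vecD extend_vecZ).
Qed.

Lemma extend_ext_pow U (j : nat) :
  (extend g (ext_pow U j) <= ext_pow (extend extend_vec U) j)%VS.
Proof.
rewrite /=; elim: j => [|j IH].
  rewrite !expv0; apply/(extend_subP gD gZ) => _ /vlineP[c ->].
  by rewrite gZ g1 memvZ ?memv_line.
rewrite !expvSr; apply: extendM_sub => x y xj /g_ext_sub yU; apply: memv_mul => //.
exact: (extend_subP gD gZ _ _ IH).
Qed.

Lemma extend_ext_ideal U :
  (extend g (ext_ideal U) <= ext_ideal (extend extend_vec U))%VS.
Proof.
by apply: extendM_sub => x y /g_ext_sub xU _; rewrite memv_mul ?memvf.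
Qed.

Lemma extend_ext_full : extend g fullv = fullv.
Proof.
apply: ext_subspace_full; first by rewrite -g1 (mem_extend gD gZ) ?memvf.
rewrite -extend_vec_full; apply: subv_trans (prodvSr _ (ext_sub_extend _)) _.
by apply: subv_trans (extendM _ _) _; rewrite (extendS gD gZ) ?subvf.
Qed.

Lemma dim_ext_rV : \dim {:exterior V} = \dim {:exterior VK}.
Proof. by rewrite !dim_exterior -dim_rV. Qed.

End ExtendExterior.

(** * Descent to an arbitrary field *)

Lemma lambda_ge_of_extension (F K : fieldType) (s : {rmorphism F -> K})
    (c : nat -> K) (V : vectType F) (m : nat) (A B : 'I_m -> {vspace V})
    (u : 'I_m -> exterior V) (M : {vspace exterior V}) (k : nat) :
  injective c ->
  (forall i, (A i :&: B i)%VS = 0%VS) ->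
  (forall i j, i != j -> (A i :&: B j)%VS != 0%VS) ->
  (forall i, u i \in ext_pow (A i) (\dim (A i))) -> (forall i, u i != 0) ->
  is_ideal M ->
  (\sum_(i < m) (amull (u i) @: ext_ideal (B i)) <= M)%VS ->
  (M <= \bigcap_(i < m) ext_ideal (B i))%VS ->
  (\sum_(i < m) \dim (B i) *
     binz (\dim {:V} - \dim (A i) - \dim (B i)) (k%:Z - (\dim (A i))%:Z))%N%:Z
  <= k.+1%:Z * (\dim (ideal_part M k.+1))%:Z
     - ((\dim {:V})%:Z - k%:Z) * (\dim (ideal_part M k))%:Z.
Proof.
move=> c_inj AB0 ABn0 u_in u_neq0 /andP[_ MV] M_ge M_le.
have [g [gD gZ gM g1 g_in]] := extend_exterior s V.
pose xV := extend (@extend_vec _ _ s V); pose xE := extend g.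
have dimV U : \dim (xV U) = \dim U.
  apply: (dim_extend (@extend_vecD _ _ s V) (@extend_vecZ _ _ s V)).
    exact: extend_vec_full.
  exact: dim_rV.
have fullE := extend_ext_full gD gZ gM g1 g_in.
have dimE X : \dim (xE X) = \dim X.
  by apply: (dim_extend gD gZ _ fullE); apply: dim_ext_rV.
have mem_xV (U : {vspace V}) v : v \in U -> extend_vec s v \in xV U.
  exact: mem_extend (@extend_vecD _ _ s V) (@extend_vecZ _ _ s V) U v.
have mem_xE (X : {vspace exterior V}) x : x \in X -> g x \in xE X by apply: mem_extend.
(* The sum of the extensions contains the extension of A_i + B_i, which has dimension a_i + b_i. *)
have xAB0 i : (xV (A i) :&: xV (B i) = 0)%VS.
  apply/eqP; rewrite -dimv_eq0; have := dimv_sum_cap (xV (A i)) (xV (B i)).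
  have := dimvS (extendD (@extend_vecD _ _ s V) (@extend_vecZ _ _ s V) (A i) (B i)).
  rewrite -/(xV _) -/(xV _) -/(xV _) !dimV (dimv_disjoint_sum (AB0 i)); lia.
have xu_in i : g (u i) \in ext_pow (xV (A i)) (\dim (xV (A i))).
  by rewrite dimV; apply/(subvP (extend_ext_pow gD gZ gM g1 g_in _ _))/mem_xE/u_in.
have xu_neq0 i : g (u i) != 0.
  by apply: (semilinear_neq0 gD gZ fullE) (u_neq0 i); apply: dim_ext_rV.
have xu_mem i j : i != j -> g (u i) \in ext_ideal (xV (B j)).
  move=> nij; apply: ext_pow_dim_ideal (xu_in i).
  (* A nonzero common vector of A_i and B_j stays nonzero over K. *)
  have x0 : vpick (A i :&: B j)%VS != 0 by rewrite vpick0 ABn0.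
  have /memv_capP[xA xB] := memv_pick (A i :&: B j)%VS.
  apply: contraTneq (mem_xV _ _ xA) => xAB0'; apply/negP => gA.
  have : extend_vec s (vpick (A i :&: B j)%VS) != 0.
    apply: (semilinear_neq0 (@extend_vecD _ _ s V) (@extend_vecZ _ _ s V)) => //.
      exact: extend_vec_full.
    exact: dim_rV.
  by rewrite -memv0 -xAB0' memv_cap gA mem_xV.
have sM : sandwiched (fun i => xV (A i)) (fun i => xV (B i)) (fun i => g (u i))
    setT 0 (fun j => xE (ideal_part M j)).
  split=> [j|j|j|i _].
  - apply: subv_trans (extendS gD gZ (capvSr _ _)) _.
    apply: subv_trans (extend_ext_pow gD gZ gM g1 g_in _ _) _.
    exact: ext_pow_sub.
  - rewrite -(extend_vec_full s V).
    apply: subv_trans (prodvSr _ (ext_sub_extend gD gZ g_in _)) _.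
    apply: subv_trans (extendM gD gZ gM _ _) _; apply: (extendS gD gZ).
    apply/prodvP => x y /memv_capP[Mx xj] yV; rewrite memv_cap -ext_powS.
    by rewrite (subvP MV) ?memv_mul ?memvf.
  - by rewrite /ideal_part /ext_ideal /ext_sub limg0 prod0v cap0v sub0v.
  split=> [||j]; first exact: capv0.
    apply: subv_trans (prodvSr _ (ext_sub_extend gD gZ g_in _)) _.
    have line : (<[g (u i)]> <= xE <[u i]>)%VS by rewrite -memvE mem_xE ?memv_line.
    apply: subv_trans (prodvSl _ line) _.
    apply: subv_trans (extendM gD gZ gM _ _) _; rewrite dimV; apply: (extendS gD gZ).
    apply/prodvP => _ x /vlineP[a ->] xB; rewrite -scalerAl memvZ // memv_cap.
    rewrite -ext_powS memv_mul ?u_degree //; last first.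
      by apply: (subvP (ext_subS (subvf _))) xB.
    rewrite andbT; apply: (subvP M_ge); apply: (subvP (sumv_sup i _ (subvv _))) => //.
    apply/memv_imgP; exists x; last by rewrite lfunE.
    by rewrite -[x]mulr1 memv_mul ?memvf.
  rewrite addv0; apply: subv_trans (extend_ext_ideal gD gZ gM g_in _).
  apply: (extendS gD gZ); apply: subv_trans (capvSl _ _) _; apply: subv_trans M_le _.
  exact: bigcapv_inf.
have := sandwiched_lambda xAB0 xu_in xu_neq0 xu_mem k c_inj _ sM.
move=> /(_ (\dim {:V})); rewrite dimv0 add0n => /(_ (dim_rV _ _)).
rewrite /reldim !dimE.
have idl0 j : ideal_part (ext_ideal (0 : {vspace 'rV[K]_(\dim {:V})})) j = 0%VS.
  by rewrite /ideal_part /ext_ideal /ext_sub limg0 prod0v cap0v.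
rewrite !idl0 !dimv0 !subr0; congr (Posz _ <= _).
by apply: eq_big => i; rewrite ?inE // !dimV.
Qed.

Theorem theorem3p1 (F : fieldType) (V : vectType F) (n : nat)
    (dimV : \dim {:V} = n) (m : nat) (A B : 'I_m -> {vspace V})
    (A_gt0 : forall i, (0 < \dim (A i))%N)
    (B_gt0 : forall i, (0 < \dim (B i))%N)
    (AB0 : forall i, (A i :&: B i)%VS = 0%VS)
    (ABn0 : forall i j, i <> j -> (A i :&: B j)%VS <> 0%VS)
    (u : 'I_m -> exterior V)
    (u_in : forall i, u i \in ext_pow (A i) (\dim (A i)))
    (u_neq0 : forall i, u i <> 0)
    (M : {vspace exterior V}) (M_graded : graded_ideal M)
    (M_ge : (\sum_(i < m) (amull (u i) @: ext_ideal (B i)) <= M)%VS)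
    (M_le : (M <= \bigcap_(i < m) ext_ideal (B i))%VS)
    (k : int) (k_ge0 : 0 <= k) (k_le : k <= n%:Z + 1) :
  (\sum_(i < m) (\dim (B i) *
      binz (n - \dim (A i) - \dim (B i)) (k - (\dim (A i))%:Z - 1))%N)%:Z
    <= lambda n M k.
Proof.
subst n; have [idM _ _] := M_graded.
(* The powers of X are distinct, so F(X) is infinite even when F is finite. *)
have c_inj : injective (fun i => tofrac ('X^i : {poly F}) : {fraction {poly F}}).
  move=> i j /eqP; rewrite tofrac_eq => /eqP/(congr1 (fun p : {poly F} => size p)).
  by rewrite !size_polyXn => -[].
pose s : {rmorphism F -> {fraction {poly F}}} := @tofrac _ \o polyC.
(* At k = 0 both sides vanish: M_(-1) = 0 and the lower indices are negative. Otherwise the bound is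
   the shifted one at j = k - 1. *)
have [->|[j ->]] : k = 0 \/ exists j : nat, k = j.+1.
- by case: k k_ge0 {k_le} => [[|j]|] // _; [left | right; exists j].
- rewrite big1 => [|i _]; last first.
    by rewrite (_ : _ - 1 = Negz (\dim (A i))) ?muln0 //; lia.
  rewrite /lambda /ideal_part mul0r sub0r (_ : 0 - 1 = Negz 0) //=.
  by rewrite capv0 dimv0 mulr0.
have ABn0' i j' : i != j' -> (A i :&: B j')%VS != 0%VS.
  by move/eqP/ABn0/eqP.
have u_neq0' i : u i != 0 by apply/eqP.
have := lambda_ge_of_extension s j c_inj AB0 ABn0' u_in u_neq0' idM M_ge M_le.
rewrite /lambda (_ : j.+1%:Z - 1 = j); last by lia.
rewrite (_ : (\dim {:V})%:Z - j.+1%:Z + 1 = (\dim {:V})%:Z - j%:Z); last by lia.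
congr (Posz _ <= _); apply: eq_bigr => i _.
by congr (_ * binz _ _)%N; lia.
Qed.
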